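(* Let $G$ be a finite non-abelian group, let $p$ be the smallest prime dividing $|G|$, and let $g \in K(G,G)$ with $g \neq 1$. Let $|E(\Gamma_G^g)|$ denote the number of edges of $\Gamma_G^g$. Then: (a) If $g^2 = 1$, then $$\frac{(p-2)|G|^2 + 2|Z(G)||G| + 3p|Z(G)|^2 - p|G|}{2p} \leq |E(\Gamma_G^g)| \leq \frac{(p+1)|G|^2 - 4p|Z(G)|^2 - |G||Z(G)| - p|G|}{2p}.$$ (b) If $g^2 \neq 1$, then $$\frac{(p-4)|G|^2 + 4|Z(G)||G| + 6p|Z(G)|^2 - p|G|}{2p} \leq |E(\Gamma_G^g)| \leq \frac{(p+2)|G|^2 - 8p|Z(G)|^2 - 2|G||Z(G)| - p|G|}{2p}.$$
   Context: For $x,y$ in a group, $[x,y] = x^{-1}y^{-1}xy$, and $K(G,G) = \{[x,y] : x,y \in G\}$. $Z(G)$ is the center of $G$. The $g$-noncommuting graph $\Gamma_G^g$ is the simple undirected graph with vertex set $G$ in which two distinct vertices $x,y$ are adjacent if and only if $[x,y] \neq g$ and $[x,y] \neq g^{-1}$. *)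

(* Defs.v *)
From mathcomp Require Import all_boot all_order all_algebra all_fingroup all_solvable.

Set Implicit Arguments.
Unset Strict Implicit.
Unset Printing Implicit Defensive.

Local Open Scope group_scope.

(* The library commutator is [~ x, y] = x^-1 * x ^ y = x^-1 * y^-1 * x * y. *)
Definition noncomm_adj (gT : finGroupType) (g : gT) : rel gT :=
  fun x y => [&& x != y, [~ x, y] != g & [~ x, y] != g^-1].

(* Since noncomm_adj is irreflexive and symmetric, the edges of the simple
   graph are the unordered pairs [set x; y] of adjacent vertices. *)
Definition noncomm_edges (gT : finGroupType) (G : {set gT}) (g : gT) :
    {set {set gT}} :=
  [set [set x; y] | x in G, y in G & noncomm_adj g x y].

(* Main.v *)
Require Import Defs.
From mathcomp Require Import all_boot all_order all_algebra all_fingroup all_solvable.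
From mathcomp Require Import zify lra.

(** Removing from G x G the diagonal and the set B of pairs whose commutator
    is g or g^-1 leaves exactly the ordered adjacent pairs, and every edge
    accounts for two of these; since g != 1, the diagonal misses B, so
      2 |E| + |G| + |B| = |G|^2     ([card_noncomm_edges]).
    For fixed x, the solutions y of [x, y] = h lie in one coset of the
    centraliser of x, which has index at least p when x is not central; there
    are none when x is central and h != 1.  Hence each of the two equations
    [x, y] = g and [x, y] = g^-1 has at most |G| (|G| - |Z(G)|) / p solutions
    ([card_commg_fiber]), and they are the same equation when g^2 = 1.
    Finally Z(G) < C_G(x) < G for a noncentral x, so |G| >= p^2 |Z(G)|, and
    therefore |G| (|G| - |Z(G)|) >= 6 p |Z(G)|^2 ([center_sqr_bound]).  Write
    X for |G| (|G| - |Z(G)|).  The lower bounds on |E| hold because the number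
    of solutions of each equation is at most X / p <= 2 X / p - 3 |Z(G)|^2;
    for the upper bounds the trivial estimate |B| >= 0 is enough, because
    4 p |Z(G)|^2 <= X makes the right-hand sides at least (|G|^2 - |G|) / 2. *)

Set Implicit Arguments.
Unset Strict Implicit.
Unset Printing Implicit Defensive.

Import Order.TTheory GRing.Theory Num.Theory.

Section CommutatorCount.

Local Open Scope group_scope.

Variable gT : finGroupType.
Implicit Types (G H K : {group gT}) (g h x y : gT).

Definition commg_fiber (A : {set gT}) (h : gT) : {set gT * gT} :=
  [set u in setX A A | [~ u.1, u.2] == h].

(** The index of H in K is a divisor of |G| other than 1, so it is at least the
    least prime divisor of |G|. *)
Lemma pdiv_mul_card_proper G H K :
  K \subset G -> H \proper K -> (pdiv #|G| * #|H| <= #|K|)%N.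
Proof.
move=> sKG pHK; have sHK := proper_sub pHK.
rewrite -(Lagrange sHK) mulnC leq_mul2l; apply/orP; right.
apply: pdiv_min_dvd; first by rewrite indexg_gt1 (proper_subn pHK).
exact: dvdn_trans (dvdn_indexg K H) (cardSg sKG).
Qed.

Lemma proper_cent1 G x : x \in G :\: 'Z(G) -> 'C_G[x] \proper G.
Proof.
rewrite in_setD => /andP[xZ xG]; rewrite properE subsetIl subsetI subxx /=.
by apply: contra xZ => sGC; rewrite inE xG -sub_cent1.
Qed.

Lemma proper_center_cent1 G x : x \in G :\: 'Z(G) -> 'Z(G) \proper 'C_G[x].
Proof.
rewrite in_setD => /andP[xZ xG]; apply/properP; split.
  by rewrite setIS // -cent_set1 centS // sub1set.
by exists x; rewrite // inE xG cent1id.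
Qed.

Lemma card_commg_fiber_cent1 G x h :
  (#|[set y in G | [~ x, y] == h]| <= #|'C_G[x]|)%N.
Proof.
have [->|[y0]] := set_0Vmem [set y in G | [~ x, y] == h]; first by rewrite cards0.
rewrite inE => /andP[y0G /eqP hy0]; rewrite -(card_rcoset 'C_G[x] y0).
apply/subset_leq_card/subsetP => y; rewrite inE => /andP[yG /eqP hy].
(* [x, y] = [x, y0] says x ^ y = x ^ y0, that is, y * y0^-1 fixes x. *)
rewrite mem_rcoset inE groupM ?groupV //=.
have: x ^ y = x ^ y0 by apply: (mulgI x^-1); rewrite -!commgEl hy hy0.
move=> exy; apply/cent1P/commute_sym/commgP/conjg_fixP.
by rewrite conjgM exy conjgK.
Qed.

(** Only noncentral x contribute, each at most |C_G(x)| <= |G| / p. *)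
Lemma card_commg_fiber G h : h != 1 ->
  (pdiv #|G| * #|commg_fiber G h| <= #|G| * (#|G| - #|'Z(G)|))%N.
Proof.
move=> h1.
have -> : #|commg_fiber G h| =
    (\sum_(x in G) #|[set y in G | [~ x, y] == h]|)%N.
  rewrite -sum1_card; under [RHS]eq_bigr => x _ do rewrite -sum1_card.
  rewrite pair_big_dep /=; apply: eq_bigl => -[x y].
  by rewrite !inE /= andbA.
rewrite (big_setID 'Z(G)) /= [X in (X + _)%N]big1 => [|x].
  rewrite add0n big_distrr /= -(cardsDS (center_sub G)) mulnC -sum_nat_const.
  apply: leq_sum => x xGZ.
  apply: leq_trans (pdiv_mul_card_proper (subxx G) (proper_cent1 xGZ)).
  by rewrite leq_mul2l card_commg_fiber_cent1 orbT.
rewrite inE => /andP[xG /centerP[_ cx]]; apply: eq_card0 => y.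
rewrite !inE; case: (boolP (y \in G)) => //= yG.
by have /commgP/eqP-> := cx y yG; rewrite eq_sym (negPf h1).
Qed.

(** For noncentral x, the strict chain Z(G) < C_G(x) < G gives
    |G| >= p^2 |Z(G)|; with p >= 2 this yields |G| >= 2 p |Z(G)| and
    |G| - |Z(G)| >= 3 |Z(G)|. *)
Lemma center_sqr_bound G : ~~ abelian G ->
  (6 * pdiv #|G| * #|'Z(G)| ^ 2 <= #|G| * (#|G| - #|'Z(G)|))%N.
Proof.
move=> nabG.
have [x xGZ] : exists x, x \in G :\: 'Z(G).
  apply/set0Pn; rewrite setD_eq0; apply: contra nabG => sGZ.
  exact: abelianS sGZ (center_abelian G).
have pZC := pdiv_mul_card_proper (subsetIl G 'C[x]) (proper_center_cent1 xGZ).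
have pCG := pdiv_mul_card_proper (subxx G) (proper_cent1 xGZ).
have p2 : (1 < pdiv #|G|)%N.
  apply/prime_gt1/pdiv_prime; rewrite cardG_gt1.
  by apply: contra nabG => /eqP ->; apply: abelian1.
have arith p z c n : (p * z <= c)%N -> (p * c <= n)%N -> (1 < p)%N ->
    (6 * p * z ^ 2 <= n * (n - z))%N.
  move=> pzc pcn p_gt1.
  have n2pz : (2 * (p * z) <= n)%N by nia.
  have n3z : (3 * z <= n - z)%N by nia.
  by apply: leq_trans (leq_mul n2pz n3z); nia.
exact: arith pZC pCG p2.
Qed.

Lemma noncomm_adj_sym g : symmetric (noncomm_adj g).
Proof.
move=> x y; rewrite /noncomm_adj eq_sym -[[~ x, y]]invgK invg_comm.
by rewrite (inj_eq invg_inj) -(inj_eq invg_inj) invgK andbA [in RHS]andbA andbAC.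
Qed.

Definition noncomm_arcs (A : {set gT}) (g : gT) : {set gT * gT} :=
  [set u in setX A A | noncomm_adj g u.1 u.2].

Lemma set2_eq (T : finType) (a b x y : T) : a != b ->
  ([set a; b] == [set x; y]) = ((a, b) \in [set (x, y); (y, x)]).
Proof.
move=> ab; rewrite !inE !xpair_eqE; apply/eqP/idP => [e|].
  have: a \in [set x; y] by rewrite -e set21.
  have: b \in [set x; y] by rewrite -e set22.
  rewrite !inE => /orP[]/eqP eb /orP[]/eqP ea; move: ab;
    by rewrite ea eb ?eqxx ?orbT.
by case/orP=> /andP[/eqP-> /eqP->] //; rewrite setUC.
Qed.

(** Each edge {x, y} is the image of exactly the two arcs (x, y), (y, x). *)
Lemma card_noncomm_arcs G g :
  #|noncomm_arcs G g| = (2 * #|noncomm_edges G g|)%N.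
Proof.
pose e (u : gT * gT) := [set u.1; u.2].
have -> : noncomm_edges G g = e @: noncomm_arcs G g.
  apply/setP => s; apply/imset2P/imsetP.
    case=> x y xG; rewrite inE => /andP[yG a] ->.
    by exists (x, y); rewrite // !inE xG yG.
  case=> -[x y]; rewrite !inE /= => /andP[/andP[xG yG] a] ->.
  by exists x y; rewrite // inE yG.
rewrite -sum1_card (partition_big_imset e) /= mulnC -sum_nat_const.
apply: eq_bigr => _ /imsetP[[x y] xyA ->]; rewrite sum1_card.
move: (xyA); rewrite !inE /= => /andP[/andP[xG yG] a].
have xy : x != y by case/and3P: a.
have -> : 2 = #|[set (x, y); (y, x)]| by rewrite cards2 xpair_eqE (negPf xy).
apply: eq_card => -[u v]; apply/idP/idP.
  move=> /andP[]; rewrite inE /= => /andP[_ /and3P[uv _ _]].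
  by rewrite /e /= set2_eq.
move=> uvP; have uvA : (u, v) \in noncomm_arcs G g.
  move: uvP; rewrite !inE => /orP[]/eqP[-> ->] /=; rewrite xG yG //=.
  by rewrite noncomm_adj_sym.
rewrite unfold_in /= uvA /= /e /= set2_eq //.
by move: uvA; rewrite inE /= => /andP[_ /and3P[]].
Qed.

Lemma card_noncomm_edges G g : g != 1 ->
  (2 * #|noncomm_edges G g| + #|G| + #|commg_fiber G g :|: commg_fiber G g^-1|
    = #|G| ^ 2)%N.
Proof.
move=> g1; rewrite -card_noncomm_arcs.
pose D := [set (x, x) | x in G]; pose B := commg_fiber G g :|: commg_fiber G g^-1.
have cD : #|D| = #|G| by rewrite card_imset // => x y [].
have inD u v : ((u, v) \in D) = (u \in G) && (u == v).
  apply/imsetP/andP => [[x xG [-> ->]]|[uG /eqP <-]]; first by rewrite xG.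
  by exists u.
have dAD : [disjoint noncomm_arcs G g & D].
  apply/pred0P => -[x y] /=; rewrite inD !inE /noncomm_adj /=.
  by case: eqP => _; rewrite /= ?andbF.
have dADB : [disjoint noncomm_arcs G g :|: D & B].
  apply/pred0P => -[x y] /=; rewrite inE inD !inE /noncomm_adj /=.
  have [-> /=|xy /=] := eqVneq x y.
    by rewrite commgg ![1 == _]eq_sym invg_eq1 (negPf g1) !andbF.
  by case: eqP; case: eqP => _ _; rewrite /= ?andbF.
have cardU (S T : {set gT * gT}) :
    [disjoint S & T] -> (#|S| + #|T| = #|S :|: T|)%N.
  by move=> dST; apply/esym/eqP; rewrite (leq_card_setU S T).
rewrite -[in LHS]cD -/B !cardU // expnS expn1 -cardsX; apply: eq_card => -[x y].
rewrite !(inD, inE) /noncomm_adj /=.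
have [-> /=|xy /=] := eqVneq x y; first by case: (y \in G); rewrite ?orbT.
by case: (x \in G); case: (y \in G); rewrite //=; case: eqP; case: eqP.
Qed.

End CommutatorCount.

Local Open Scope ring_scope.

Theorem corollary4p6 (gT : finGroupType) (G : {group gT}) (p : nat) (g : gT)
    (hG : ~~ abelian G) (hp : p = pdiv #|G|)
    (hgK : g \in commg_set G G) (hg1 : g != 1%g) :
  let n : rat := #|G|%:R in
  let z : rat := #|'Z(G)%g|%:R in
  let q : rat := p%:R in
  let m : rat := #|noncomm_edges G g|%:R in
  ((g ^+ 2)%g = 1%g ->
     ((q - 2) * n ^+ 2 + 2 * z * n + 3 * q * z ^+ 2 - q * n) / (2 * q) <= m
     /\ m <= ((q + 1) * n ^+ 2 - 4 * q * z ^+ 2 - n * z - q * n) / (2 * q))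
  /\
  ((g ^+ 2)%g <> 1%g ->
     ((q - 4) * n ^+ 2 + 4 * z * n + 6 * q * z ^+ 2 - q * n) / (2 * q) <= m
     /\ m <= ((q + 2) * n ^+ 2 - 8 * q * z ^+ 2 - 2 * n * z - q * n) / (2 * q)).
Proof.
move=> n z q m; subst p.
set b : rat := #|commg_fiber G g :|: commg_fiber G g^-1%g|%:R.
have q0 : 0 < q by rewrite ltr0n pdiv_gt0.
have qb0 : 0 <= q * b by rewrite mulr_ge0 // ?ler0n // ltW.
have edges : n ^+ 2 = 2 * m + n + b.
  by rewrite -natrX -(card_noncomm_edges G hg1) 2!natrD natrM.
have castNZ : (#|G| * (#|G| - #|'Z(G)%g|))%:R = n * (n - z) :> rat.
  by rewrite natrM natrB // subset_leq_card // center_sub.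
have centerB : 6 * q * z ^+ 2 <= n * (n - z).
  by rewrite -castNZ -natrX -!natrM ler_nat center_sqr_bound.
have gV1 : g^-1%g != 1%g by rewrite invg_eq1.
have qedges : q * n ^+ 2 = q * (2 * m + n + b) by rewrite edges.
have z0 : 0 <= z ^+ 2 by rewrite exprn_ge0 // ler0n.
have qz0 : 0 <= q * z ^+ 2 by rewrite mulr_ge0 // ltW.
have q2 : 0 < 2 * q by rewrite mulr_gt0.
split=> [g2|_].
  have fiberB : q * b <= n * (n - z).
    have gV : g^-1%g = g by apply/eqP; rewrite eq_invg_mul -g2 expgS expg1.
    by rewrite -castNZ /b gV setUid -natrM ler_nat card_commg_fiber.
  by split; [rewrite ler_pdivrMr // | rewrite ler_pdivlMr //]; nra.
have fiberB : q * b <= 2 * (n * (n - z)).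
  rewrite -castNZ -!natrM ler_nat mul2n -addnn.
  apply: leq_trans (leq_add (card_commg_fiber G hg1) (card_commg_fiber G gV1)).
  by rewrite -mulnDr leq_mul2l (leq_card_setU _ _) orbT.
by split; [rewrite ler_pdivrMr // | rewrite ler_pdivlMr //]; nra.
Qed.
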